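(* Let $p$ be a prime and let $\mathcal{F}$ be a fusion system over a finite $p$-group $S$. Assume that all morphisms in $\mathcal{F}$ are composites of restrictions of morphisms of $\mathcal{F}$ between $\mathcal{F}$-centric subgroups of $S$. If $\mathcal{F}$ satisfies the axioms of saturation (I) and (II) when applied to $\mathcal{F}$-centric subgroups $P$ of $S$ (that is, (I) and (II) hold for every $\mathcal{F}$-centric $P\le S$), then $\mathcal{F}$ is saturated.
   Context: For subgroups $P,Q$ of a finite $p$-group $S$: $c_x$ denotes conjugation $g\mapsto xgx^{-1}$; $\mathrm{Hom}_S(P,Q)$ is the set of homomorphisms $P\to Q$ induced by conjugation by elements of $S$; $\mathrm{Aut}_S(P)=\mathrm{Hom}_S(P,P)$; $\mathrm{Inj}(P,Q)$ is the set of injective homomorphisms. A fusion system $\mathcal{F}$ over $S$ is a category whose objects are all subgroups of $S$, whose morphisms are group homomorphisms (with the usual composition), such that for all $P,Q\le S$: $\mathrm{Hom}_S(P,Q)\subseteq \mathrm{Hom}_{\mathcal{F}}(P,Q)\subseteq \mathrm{Inj}(P,Q)$, and each $\varphi\in\mathrm{Hom}_{\mathcal{F}}(P,Q)$ is the composite of an isomorphism in $\mathcal{F}$ followed by an inclusion. Write $\mathrm{Aut}_{\mathcal{F}}(P)=\mathrm{Hom}_{\mathcal{F}}(P,P)$. Two subgroups are $\mathcal{F}$-conjugate if they are isomorphic in $\mathcal{F}$. $P\le S$ is $\mathcal{F}$-centric if $C_S(P')=Z(P')$ for all $P'$ $\mathcal{F}$-conjugate to $P$. $P$ is fully centralized (resp.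 fully normalized) in $\mathcal{F}$ if $|C_S(P)|\ge|C_S(P')|$ (resp. $|N_S(P)|\ge|N_S(P')|$) for all $P'$ $\mathcal{F}$-conjugate to $P$. Axioms of saturation, for a subgroup $P\le S$: (I) If $P$ is fully normalized in $\mathcal{F}$, then $P$ is fully centralized in $\mathcal{F}$ and $\mathrm{Aut}_S(P)$ is a Sylow $p$-subgroup of $\mathrm{Aut}_{\mathcal{F}}(P)$. (II) If $\varphi\in\mathrm{Hom}_{\mathcal{F}}(P,S)$ is such that $\varphi(P)$ is fully centralized, and $N_\varphi=\{g\in N_S(P)\mid \varphi c_g\varphi^{-1}\in\mathrm{Aut}_S(\varphi(P))\}$, then there is $\overline{\varphi}\in\mathrm{Hom}_{\mathcal{F}}(N_\varphi,S)$ with $\overline{\varphi}|_P=\varphi$. $\mathcal{F}$ is saturated if (I) and (II) hold for all $P\le S$. *)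

(* Defs.v *)
From HB Require Import structures.
From mathcomp Require Import all_boot all_fingroup all_solvable.

Set Implicit Arguments.
Unset Strict Implicit.
Unset Printing Implicit Defensive.

Import GroupScope.

(* The ambient group is a finite group type S, so that the subgroups of S are  *)
(* exactly the terms of type {group S}, C_S(P) is 'C(P), and N_S(P) is 'N(P).  *)
(* A homomorphism P -> Q is represented by the unique function S -> S that     *)
(* extends it and is equal to 1 outside P; thus equality of homomorphisms      *)
(* with domain P is Leibniz equality, and Hom-sets are finite sets.            *)

Section Homomorphisms.

Variable S : finGroupType.
Implicit Types (P Q R : {set S}) (x y : S) (f g : {ffun S -> S}).

Definition inj_hom P Q : {set {ffun S -> S}} :=
  [set f : {ffun S -> S} | [&& morphic P f, dinjectiveb f P,
     f @: P \subset Q & 1.-support f \subset P]].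

Definition fres P (h : S -> S) : {ffun S -> S} :=
  [ffun x => if x \in P then h x else 1].

Definition fincl P : {ffun S -> S} := fres P id.

(* g \o f; it is 1 outside the domain of f as soon as g 1 = 1. *)
Definition fcomp g f : {ffun S -> S} := [ffun x => g (f x)].

(* The inverse f @: P -> P of an injective homomorphism f with domain P. *)
Definition fhom_inv P f : {ffun S -> S} :=
  fres (f @: P) (fun y => odflt 1 [pick x in P | f x == y]).

(* c_x : u |-> x u x^-1, which is the map u |-> u ^ x^-1 of the library. *)
Definition fconj P x : {ffun S -> S} := fres P (fun u => x * u * x^-1).

Definition hom_S P Q : {set {ffun S -> S}} :=
  [set fconj P x | x : S & fconj P x @: P \subset Q].

Definition Nphi P f : {set S} :=
  [set x in 'N(P) |
     fcomp f (fcomp (fconj P x) (fhom_inv P f)) \in hom_S (f @: P) (f @: P)].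

(* A set A of automorphisms of P, seen inside the permutation group Aut P.     *)
(* The product of permutations is composition in the opposite order, which     *)
(* affects neither subgroups nor Sylow subgroups.                              *)
Definition aut_perms P (A : {set {ffun S -> S}}) : {set {perm S}} :=
  [set a in Aut P | fres P a \in A].

Definition Aut_S P : {set {perm S}} := aut_perms P (hom_S P P).

End Homomorphisms.

Definition hom_family (S : finGroupType) :=
  {group S} -> {group S} -> {set {ffun S -> S}}.

Definition fiso (S : finGroupType) (F : hom_family S) (P Q : {group S})
    (f : {ffun S -> S}) : Prop :=
  f \in F P Q /\
  exists2 g, g \in F Q P & fcomp g f = fincl P /\ fcomp f g = fincl Q.

Record fusion_system (S : finGroupType) := FusionSystem {
  fhom : forall P Q : {group S}, {set {ffun S -> S}};
  fhom_id : forall P : {group S}, fincl P \in fhom P P;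
  fhom_comp : forall (P Q R : {group S}) (f g : {ffun S -> S}),
    f \in fhom P Q -> g \in fhom Q R -> fcomp g f \in fhom P R;
  fhom_hom_S : forall P Q : {group S}, hom_S P Q \subset fhom P Q;
  fhom_inj : forall P Q : {group S}, fhom P Q \subset inj_hom P Q;
  fhom_factor : forall (P Q : {group S}) (f : {ffun S -> S}), f \in fhom P Q ->
    exists (R : {group S}) (g : {ffun S -> S}),
      [/\ fiso fhom P R g, R \subset Q & f = fcomp (fincl R) g]
}.

Coercion fhom : fusion_system >-> Funclass.

Section FusionSystem.

Variables (S : finGroupType) (p : nat) (F : fusion_system S).
Implicit Types (P Q R : {group S}) (f g : {ffun S -> S}).

Definition F_conj P Q : Prop := exists f, fiso F P Q f.

Definition centric P : Prop := forall P', F_conj P P' -> 'C(P') = 'Z(P').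

Definition fully_centralized P : Prop :=
  forall P', F_conj P P' -> #|'C(P')| <= #|'C(P)|.

Definition fully_normalized P : Prop :=
  forall P', F_conj P P' -> #|'N(P')| <= #|'N(P)|.

Definition Aut_F P : {set {perm S}} := aut_perms P (F P P).

Definition saturation_I P : Prop :=
  fully_normalized P ->
  fully_centralized P /\ p.-Sylow(Aut_F P) (Aut_S P).

(* f @: P and Nphi P f are already subgroups (img_group_set, Nphi_group_set    *)
(* below), so taking generated subgroups only serves to package them.          *)
Definition img_group P f : {group S} := [group of <<f @: P>>].
Definition Nphi_group P f : {group S} := [group of <<Nphi P f>>].

Definition saturation_II P : Prop :=
  forall f, f \in F P [set: S]%G -> fully_centralized (img_group P f) ->
  exists2 g, g \in F (Nphi_group P f) [set: S]%G & {in P, g =1 f}.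

Definition saturated : Prop :=
  forall P, saturation_I P /\ saturation_II P.

(* Composites of restrictions of morphisms between centric subgroups, where a  *)
(* restriction of f : P -> Q is the induced map P0 -> Q0 for P0 <= P and       *)
(* f(P0) <= Q0 <= Q. Identities are restrictions of the identity of S.         *)
Inductive centric_generated : {group S} -> {group S} -> {ffun S -> S} -> Prop :=
| cg_restr P Q P0 Q0 f :
    centric P -> centric Q -> f \in F P Q ->
    P0 \subset P -> Q0 \subset Q -> f @: P0 \subset Q0 ->
    centric_generated P0 Q0 (fres P0 f)
| cg_comp P Q R f g :
    centric_generated P Q f -> centric_generated Q R g ->
    centric_generated P R (fcomp g f).

End FusionSystem.

Section GroupSets.

Variable S : finGroupType.
Implicit Types (P Q : {group S}) (f : {ffun S -> S}).

Lemma inj_homP P Q f :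
  reflect [/\ {in P &, {morph f : x y / x * y}}, {in P &, injective f},
              f @: P \subset Q & forall x, x \notin P -> f x = 1]
          (f \in inj_hom P Q).
Proof.
rewrite inE; apply: (iffP and4P) => [] [fM fI fQ fP]; split => //.
- exact/morphicP.
- exact/dinjectiveP.
- by move=> x xP; apply/eqP; apply: contraNT xP => fx; apply: (subsetP fP).
- exact/morphicP.
- exact/dinjectiveP.
- by apply/subsetP=> x; rewrite inE; apply: contraR => /fP->.
Qed.

Lemma img_group_set P Q f : f \in inj_hom P Q -> group_set (f @: P).
Proof.
case/inj_homP=> fM _ _ _; apply/group_setP; split.
  have f1: f 1 = 1 by apply: (mulgI (f 1)); rewrite -fM // !mulg1.
  by rewrite -f1 imset_f.
by move=> _ _ /imsetP[x Px ->] /imsetP[y Py ->]; rewrite -fM // imset_f ?groupM.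
Qed.

Lemma fhom_invK P Q f : f \in inj_hom P Q -> {in P, cancel f (fhom_inv P f)}.
Proof.
case/inj_homP=> _ fI _ _ x Px; rewrite ffunE imset_f //.
case: pickP => [y /andP[Py /eqP/fI->] // | /(_ x)].
by rewrite Px eqxx.
Qed.

Lemma NphiP P Q f (g : S) : f \in inj_hom P Q ->
  reflect (g \in 'N(P) /\ exists2 h, h \in 'N(f @: P) &
             {in P, forall x, f (g * x * g^-1) = h * f x * h^-1})
          (g \in Nphi P f).
Proof.
move=> fPQ; have fK := fhom_invK fPQ; case/inj_homP: (fPQ) => fM _ _ f0.
have f1: f 1 = 1 by apply: (mulgI (f 1)); rewrite -fM // !mulg1.
have nP x y (R : {set S}) : (forall z, z \in R -> x * z * x^-1 \in R) -> y = x ->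
    y \in 'N(R).
  move=> nR ->; rewrite -groupV inE; apply/subsetP=> _ /imsetP[z Rz ->].
  by rewrite conjgE invgK mulgA nR.
apply: (iffP setIdP) => [] [nPg].
  case/imsetP=> h; rewrite inE => /subsetP hN /ffunP fE; split=> //.
  exists h => [|x Px].
    apply: (nP h) => // z Rz; apply: hN; apply/imsetP; exists z => //.
    by rewrite ffunE Rz.
  have:= fE (f x); have:= fK x Px; rewrite /fcomp /fconj /fres.
  by rewrite !ffunE imset_f // => ->; rewrite Px.
case=> h nh hE; split=> //; apply/imsetP; exists h.
  rewrite inE; apply/subsetP=> _ /imsetP[z Rz ->]; rewrite ffunE Rz.
  by have:= memJ_norm z (groupVr nh); rewrite conjgE invgK mulgA Rz => ->.
apply/ffunP=> y; have [/imsetP[x Px ->] | fPy] := boolP (y \in f @: P).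
  by have:= fK x Px; rewrite !ffunE imset_f // => ->; rewrite Px hE.
by rewrite !ffunE (negPf fPy) group1 mulg1 mulgV.
Qed.

Lemma Nphi_group_set P Q f : f \in inj_hom P Q -> group_set (Nphi P f).
Proof.
move=> fPQ; apply/group_setP; split.
  apply/(NphiP _ fPQ); split; rewrite ?group1 //; exists 1; first exact: group1.
  by move=> x _; rewrite invg1 !mulg1 !mul1g.
move=> g g' /(NphiP _ fPQ)[ng [h nh hE]] /(NphiP _ fPQ)[ng' [h' nh' hE']].
apply/(NphiP _ fPQ); split; first exact: groupM.
exists (h * h') => [|x Px]; first exact: groupM.
have P'x: g' * x * g'^-1 \in P.
  by have:= memJ_norm x (groupVr ng'); rewrite conjgE invgK mulgA Px.
by have:= hE _ P'x; rewrite hE' // !invMg !mulgA.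
Qed.

(* Aut P, with its elements seen as bijective homomorphisms P -> P. *)
Lemma aut_perms_exists P f :
  f \in inj_hom P P -> exists2 a, a \in Aut P & fres P a = f.
Proof.
case/inj_homP=> fM fI fP f0.
have cP: f @: P \subset P by [].
exists (perm_in fI cP).
  rewrite inE perm_in_on /=; apply/morphicP=> x y Px Py.
  by rewrite !perm_inE ?groupM // fM.
by apply/ffunP=> x; rewrite ffunE; case: ifPn => [/perm_inE|/f0].
Qed.

Lemma aut_perms_group_set P (A : {set {ffun S -> S}}) :
  fincl P \in A -> (forall f g, f \in A -> g \in A -> fcomp g f \in A) ->
  group_set (aut_perms P A).
Proof.
move=> A1 AM; apply/group_setP; split=> [|a b].
  rewrite inE group1; congr (_ \in A): A1.
  by apply/ffunP=> x; rewrite !ffunE perm1.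
case/setIdP=> aP Aa /setIdP[bP Ab]; rewrite inE groupM //=.
congr (_ \in A): (AM _ _ Aa Ab); apply/ffunP=> x; rewrite !ffunE permM.
have [Px | _] := boolP (x \in P).
  by case/setIdP: aP => /perm_closed-> _; rewrite Px.
have /morphicP bM := Aut_morphic bP; rewrite group1.
by apply: (mulgI (b 1)); rewrite -bM // !mulg1.
Qed.

Lemma Aut_S_group_set P : group_set (Aut_S P).
Proof.
apply: aut_perms_group_set.
  apply/imsetP; exists 1; last first.
    by apply/ffunP=> x; rewrite !ffunE invg1 mulg1 mul1g.
  rewrite inE; apply/subsetP=> _ /imsetP[x Px ->].
  by rewrite ffunE Px invg1 mulg1 mul1g.
move=> f g /imsetP[x + ->] /imsetP[y + ->].
rewrite !inE => /subsetP nx /subsetP ny.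
have cP z u : u \in P -> fconj P z u = z * u * z^-1 by move=> Pu; rewrite ffunE Pu.
have E: fcomp (fconj P y) (fconj P x) = fconj P (y * x).
  apply/ffunP=> u; rewrite /fcomp ffunE [RHS]ffunE; case: ifPn => [Pu | nPu].
    by rewrite !cP ?invMg ?mulgA // -cP // nx ?imset_f.
  by rewrite [fconj P x u]ffunE (negPf nPu) cP // mulg1 mulgV.
rewrite E; apply/imsetP; exists (y * x) => //; rewrite inE -E.
by apply/subsetP=> _ /imsetP[u Pu ->]; rewrite ffunE ny ?imset_f // nx ?imset_f.
Qed.

Lemma Aut_F_group_set (F : fusion_system S) P : group_set (Aut_F F P).
Proof.
by apply: aut_perms_group_set => [|f g Ff Fg]; [apply: fhom_id | apply: fhom_comp Fg].
Qed.

End GroupSets.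

Canonical Aut_S_group (S : finGroupType) (P : {group S}) :=
  Group (Aut_S_group_set P).
Canonical Aut_F_group (S : finGroupType) (F : fusion_system S) (P : {group S}) :=
  Group (Aut_F_group_set F P).

(* Main.v *)
Require Import Defs.
From mathcomp Require Import all_boot all_fingroup all_solvable.

(* By downward induction on #|P|, assume (I) and (II) for all groups larger   *)
(* than P, and let P be non-centric, with #|'N(P)| maximal in its F-conjugacy *)
(* class.  The generation hypothesis and (II) for larger groups give, for     *)
(* each A conjugate to P, a morphism from 'N(A) to 'N(P) sending A to P.      *)
(* So P is fully centralized and, not being centric, is proper in             *)
(* PC = P 'C(P).  A Frattini-type argument modulo the automorphisms acting    *)
(* trivially on P shows that every F-automorphism of P extends to PC.  Hence  *)
(* a suitable Sylow subgroup for PC restricts to one for P, which is (I), and *)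
(* (II) for the conjugates of P follows from (II) for PC.                     *)

Set Implicit Arguments.
Unset Strict Implicit.
Unset Printing Implicit Defensive.

Import GroupScope.

(** The generation hypothesis lets morphisms between non-centric groups be studied on larger groups.
    If [A] is not centric, any centric [Q] containing [A] satisfies [A < 'N_Q(A)]
    ([embeds_proper_norm]), so each link of a composite starting at [A] extends to a group in which
    [A] is proper and normal.

    Two claims are thereby reduced to morphisms on groups [Q] with [A < Q <= 'N(A)], and follow by
    downward induction on [#|Q|]: ['N(A)] maps into ['N(P)] for every conjugate [A] of [P]
    ([embeds_step], [F_conj_embeds]), and F-automorphisms of [P] extend to [PC]
    ([normal_extendable], [aut_extendable]). Both inductions pass through a conjugate of [Q] where a
    Sylow condition holds ([receptive]); there axiom (II) extends a morphism strictly, up to an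
    automorphism that preserves the image of [A] ([receptive_extend]).

    Since [P < PC], both axioms are known for [PC]. Restriction maps the stabilizer of [P] in
    [Aut_F F PC] onto [Aut_F F P], and a Sylow subgroup to a Sylow subgroup, which gives (I)
    ([Sylow_Aut_S_P]). Axiom (II) for [PC] gives extensions of automorphisms of [P]
    ([aut_extend_norm]), carried over to all conjugates by the maps between normalizers
    ([satII_conj]). *)

Section Isomorphisms.

(** * Calculus of isomorphisms in F *)

Variables (S : finGroupType) (F : fusion_system S).
Implicit Types (A B C P Q R M : {group S}) (f g h : S -> S) (x y : S).

(** The values of [f] outside [A] are left free, so that a single function stands for all its
    restrictions and composition is plain [\o]. *)
Definition isoF A B f : bool :=
  (fres A f \in F A [set: S]%G) && (f @: A == B :> {set S}).

Lemma eq_fres (X : {set S}) f g : {in X, f =1 g} -> fres X f = fres X g.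
Proof. by move=> fg; apply/ffunP=> x; rewrite !ffunE; case: ifP => // /fg. Qed.

Lemma eq_isoF A B f g : {in A, f =1 g} -> isoF A B f = isoF A B g.
Proof. by move=> fg; rewrite /isoF (eq_fres fg) (eq_in_imset fg). Qed.

Lemma fres_inj_hom P Q (f : {ffun S -> S}) : f \in inj_hom P Q -> fres P f = f.
Proof.
case/inj_homP=> _ _ _ f1; apply/ffunP=> x; rewrite ffunE.
by case: ifPn => // /f1.
Qed.

Lemma fincl_fhom A B : A \subset B -> fincl A \in F A B.
Proof.
move=> sAB; apply: (subsetP (fhom_hom_S F A B)).
apply/imsetP; exists 1; last first.
  by apply/ffunP=> x; rewrite !ffunE invg1 mulg1 mul1g.
rewrite inE; apply/subsetP=> _ /imsetP[x Ax ->].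
by rewrite ffunE Ax invg1 mulg1 mul1g (subsetP sAB).
Qed.

Lemma fcomp_fincl P Q R (f : {ffun S -> S}) :
  f \in inj_hom P Q -> Q \subset R -> fcomp (fincl R) f = f.
Proof.
case/inj_homP=> _ _ fPQ f1 sQR; apply/ffunP=> x; rewrite !ffunE.
case: ifPn => // /negP[].
have [Px | /f1->] := boolP (x \in P); last exact: group1.
by rewrite (subsetP sQR) // (subsetP fPQ) ?imset_f.
Qed.

Lemma fhom_fiso P Q (f : {ffun S -> S}) :
  f \in F P Q -> exists2 R : {group S}, R \subset Q & fiso F P R f.
Proof.
move=> /fhom_factor[R [g [gPR sRQ ->]]]; exists R => //.
by rewrite (fcomp_fincl (subsetP (fhom_inj F P R) _ (proj1 gPR))).
Qed.

Lemma fiso_im P Q (f : {ffun S -> S}) : fiso F P Q f -> f @: P = Q.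
Proof.
case=> fF [g gF [_ /ffunP fg]]; apply/eqP; rewrite eqEsubset.
have /inj_homP[_ _ -> _] := subsetP (fhom_inj F P Q) _ fF.
have /inj_homP[_ _ gQ _] := subsetP (fhom_inj F Q P) _ gF.
apply/subsetP=> y Qy; have:= fg y; rewrite !ffunE Qy => <-.
by rewrite imset_f // (subsetP gQ) ?imset_f.
Qed.

Lemma fiso_isoF P Q (f : {ffun S -> S}) : fiso F P Q f -> isoF P Q f.
Proof.
move=> fPQ; rewrite /isoF (fiso_im fPQ) eqxx andbT.
have fF := subsetP (fhom_inj F P Q) _ (proj1 fPQ).
rewrite (fres_inj_hom fF) -(fcomp_fincl fF (subxx Q)).
exact: fhom_comp (proj1 fPQ) (fincl_fhom (subsetT Q)).
Qed.

Lemma fhom_isoF P Q (f : {ffun S -> S}) :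
  f \in F P Q -> exists2 R : {group S}, R \subset Q & isoF P R f.
Proof. by case/fhom_fiso=> R sRQ /fiso_isoF fR; exists R. Qed.

Lemma isoF_im A B f : isoF A B f -> f @: A = B.
Proof. by case/andP=> _ /eqP. Qed.

Lemma fres_im (X : {set S}) f : fres X f @: X = f @: X.
Proof. by apply: eq_in_imset => x Xx; rewrite ffunE Xx. Qed.

Lemma isoF_fiso A B f : isoF A B f -> fiso F A B (fres A f).
Proof.
case/andP=> /fhom_fiso[R _ fR] /eqP fAB.
by have:= fiso_im fR; rewrite fres_im fAB => /val_inj->.
Qed.

Lemma isoF_fhom A B f : isoF A B f -> fres A f \in F A B.
Proof. by case/isoF_fiso. Qed.

Lemma isoF_inj_hom A B f : isoF A B f -> fres A f \in inj_hom A B.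
Proof. by move/isoF_fhom; apply: (subsetP (fhom_inj F A B)). Qed.

Lemma isoFM A B f : isoF A B f -> {in A &, {morph f : x y / x * y}}.
Proof.
case/isoF_inj_hom/inj_homP=> fM _ _ _ x y Ax Ay.
by have:= fM x y Ax Ay; rewrite !ffunE groupM ?Ax ?Ay.
Qed.

Lemma isoF_inj A B f : isoF A B f -> {in A &, injective f}.
Proof.
case/isoF_inj_hom/inj_homP=> _ fI _ _ x y Ax Ay fxy.
by apply: (fI x y Ax Ay); rewrite !ffunE Ax Ay.
Qed.

Lemma isoF_mem A B f x : isoF A B f -> x \in A -> f x \in B.
Proof. by move=> /isoF_im <- Ax; apply: imset_f. Qed.

Lemma isoF1 A B f : isoF A B f -> f 1 = 1.
Proof. by move=> fAB; apply: (mulgI (f 1)); rewrite -(isoFM fAB) // !mulg1. Qed.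

Lemma isoFV A B f : isoF A B f -> {in A, {morph f : x / x^-1}}.
Proof.
move=> fAB x Ax; apply: (mulgI (f x)).
by rewrite -(isoFM fAB) ?groupV // !mulgV (isoF1 fAB).
Qed.

Lemma isoFJ A B f : isoF A B f -> {in A &, {morph f : x y / x ^ y}}.
Proof.
move=> fAB x y Ax Ay.
by rewrite !conjgE !(isoFM fAB) ?(isoFV fAB) ?groupM ?groupV.
Qed.

Lemma isoF_card A B f : isoF A B f -> #|A| = #|B|.
Proof.
by move=> fAB; rewrite -(isoF_im fAB) card_in_imset //; apply: isoF_inj fAB.
Qed.

Lemma isoF_comp A B C f g : isoF A B f -> isoF B C g -> isoF A C (g \o f).
Proof.
move=> fAB gBC; rewrite /isoF imset_comp (isoF_im fAB) (isoF_im gBC) eqxx andbT.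
have [gF _] := andP gBC; suff ->: fres A (g \o f) = fcomp (fres B g) (fres A f).
  exact: fhom_comp (isoF_fhom fAB) gF.
apply/ffunP=> x; rewrite !ffunE.
case: ifP => [Ax | _]; first by rewrite (isoF_mem fAB).
by rewrite group1 (isoF1 gBC).
Qed.

Lemma isoF_inv A B f : isoF A B f ->
  exists g, [/\ isoF B A g, {in A, cancel f g} & {in B, cancel g f}].
Proof.
move=> fAB; case: (isoF_fiso fAB) => fF [g gF [gf fg]]; exists g.
have gBA: isoF B A g by apply: fiso_isoF; split=> //; exists (fres A f).
split=> // x xX; first by have /ffunP/(_ x) := gf; rewrite !ffunE xX.
by have /ffunP/(_ x) := fg; rewrite !ffunE xX (isoF_mem gBA).
Qed.

Lemma isoF_restr A B A0 f : isoF A B f -> A0 \subset A ->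
  exists2 B0 : {group S}, B0 \subset B & isoF A0 B0 f.
Proof.
move=> fAB sA0.
have /fhom_isoF[B0 sB0] := fhom_comp (fincl_fhom sA0) (isoF_fhom fAB).
rewrite (@eq_isoF _ _ _ f) => [fB0 | x A0x]; first by exists B0.
by rewrite !ffunE A0x (subsetP sA0).
Qed.

Lemma isoF_sub A B A0 B0 f :
  isoF A B f -> A0 \subset A -> f @: A0 = B0 -> isoF A0 B0 f.
Proof.
by move=> fAB /(isoF_restr fAB)[B1 _ fB1] fB0; have:= isoF_im fB1;
  rewrite fB0 => /val_inj->.
Qed.

Lemma isoF_id A : isoF A A id.
Proof.
rewrite /isoF imset_id eqxx andbT.
exact: (@fincl_fhom A [set: S]%G (subsetT A)).
Qed.

Lemma isoF_conj A x : isoF A (A :^ x)%G (conjg^~ x).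
Proof.
rewrite /isoF eqxx andbT; apply: (subsetP (fhom_hom_S F A _)).
apply/imsetP; exists x^-1; first by rewrite inE subsetT.
by apply/ffunP=> y; rewrite !ffunE invgK conjgE mulgA.
Qed.

Lemma isoF_norm A B A0 B0 f x : isoF A B f -> A0 \subset A -> f @: A0 = B0 ->
  x \in A -> x \in 'N(A0) -> f x \in 'N(B0).
Proof.
move=> fAB /subsetP sA0 <- Ax nA0x; rewrite inE.
apply/subsetP=> _ /imsetP[_ /imsetP[y A0y ->] ->].
by rewrite -(isoFJ fAB (sA0 _ A0y) Ax) imset_f ?memJ_norm.
Qed.

Lemma isoF_cent A B A0 B0 f x : isoF A B f -> A0 \subset A -> f @: A0 = B0 ->
  x \in A -> x \in 'C(A0) -> f x \in 'C(B0).
Proof.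
move=> fAB /subsetP sA0 <- Ax /centP cA0x; apply/centP=> _ /imsetP[y A0y ->].
have Ay := sA0 _ A0y; by rewrite /commute -!(isoFM fAB) // cA0x.
Qed.

Lemma cancel_im (X Y : {set S}) f (f' : S -> S) :
  {in X, cancel f f'} -> f @: X = Y -> f' @: Y = X.
Proof.
move=> fK <-; rewrite -imset_comp -[RHS]imset_id.
by apply: eq_in_imset => x Xx /=; rewrite fK.
Qed.

Lemma isoF_im_sub A B f (X Y : {set S}) :
  isoF A B f -> X \subset A -> f @: X = Y -> Y \subset B.
Proof. by move=> fAB sXA <-; rewrite -(isoF_im fAB) imsetS. Qed.

Lemma isoF_im_norm A B A0 B0 f : isoF A B f -> A0 \subset A ->
  f @: A0 = B0 -> A \subset 'N(A0) -> B \subset 'N(B0).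
Proof.
move=> fAB sA0 fA0 /subsetP nA0A; apply/subsetP=> y.
rewrite -{1}(isoF_im fAB) => /imsetP[x Ax ->].
exact: isoF_norm fAB sA0 fA0 Ax (nA0A x Ax).
Qed.

Lemma F_conjP P Q : F_conj F P Q <-> exists f, isoF P Q f.
Proof.
split=> [[f /fiso_isoF] | [f /isoF_fiso]]; first by exists f.
by exists (fres P f).
Qed.

Lemma F_conj_sym P Q : F_conj F P Q -> F_conj F Q P.
Proof.
by move=> /F_conjP[f /isoF_inv[g [gQP _ _]]]; apply/F_conjP; exists g.
Qed.

Lemma F_conj_trans P Q R : F_conj F P Q -> F_conj F Q R -> F_conj F P R.
Proof.
move=> /F_conjP[f fPQ] /F_conjP[g gQR]; apply/F_conjP; exists (g \o f).
exact: isoF_comp fPQ gQR.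
Qed.

Lemma centric_F_conj P Q : F_conj F P Q -> centric F P -> centric F Q.
Proof. by move=> PQ cP R QR; apply: cP; apply: F_conj_trans PQ QR. Qed.

Lemma F_conj_reflect P Q :
  reflect (F_conj F P Q) [exists f : {ffun S -> S}, isoF P Q f].
Proof.
apply: (iffP existsP) => [[f fR] | /F_conjP[f fR]].
  by apply/F_conjP; exists f.
by exists (fres P f); rewrite (@eq_isoF _ _ _ f) // => x Px; rewrite ffunE Px.
Qed.

Lemma centric_reflect P :
  reflect (centric F P)
    [forall Q : {group S}, [exists f : {ffun S -> S}, isoF P Q f]
       ==> ('C(Q) == 'Z(Q))].
Proof.
apply: (iffP forallP) => [cP Q PQ | cP Q].
  by have /implyP/(_ (introT (F_conj_reflect P Q) PQ))/eqP := cP Q.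
by apply/implyP=> /F_conj_reflect/cP/eqP.
Qed.

Lemma exists_fully_normalized P :
  exists2 Q, F_conj F P Q & fully_normalized F Q.
Proof.
pose conjP Q := [exists f : {ffun S -> S}, isoF P Q f].
have PP : conjP P.
  by apply/F_conj_reflect/F_conjP; exists id; apply: isoF_id.
case: (arg_maxnP (fun Q : {group S} => #|'N(Q)|) PP).
move=> Q /F_conj_reflect PQ maxQ.
exists Q => // R QR; apply: maxQ; apply/F_conj_reflect.
exact: F_conj_trans PQ QR.
Qed.

(** * Automorphism groups as permutation groups *)

Lemma Aut_FP R a : reflect (a \in Aut R /\ isoF R R a) (a \in Aut_F F R).
Proof.
apply: (iffP setIdP) => [] [AutRa aF]; split=> //; last exact: isoF_fhom.
have [B sBR] := fhom_isoF aF.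
rewrite (@eq_isoF _ _ _ a) => [aB | x Rx]; last first.
  by rewrite ffunE Rx.
suff EB: B = R by rewrite EB in aB.
by apply/val_inj/eqP; rewrite /= eqEcard sBR -(isoF_card aB) leqnn.
Qed.

Lemma isoF_Aut R f : isoF R R f -> exists2 a, a \in Aut_F F R & {in R, a =1 f}.
Proof.
move=> fR; have [a AutRa aE] := aut_perms_exists (isoF_inj_hom fR).
have fa: {in R, a =1 f}.
  by move=> x Rx; have /ffunP/(_ x) := aE; rewrite !ffunE Rx.
by exists a => //; apply/Aut_FP; rewrite (eq_isoF _ fa).
Qed.

Lemma Aut_SP R a :
  reflect (a \in Aut R /\ exists2 x, x \in 'N(R) & {in R, forall u, a u = u ^ x})
          (a \in Aut_S R).
Proof.
apply: (iffP setIdP) => [] [AutRa aS]; split=> //.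
  case/imsetP: aS => x _ /ffunP aE; exists x^-1 => [|u Ru].
    rewrite inE; apply/subsetP=> _ /imsetP[u Ru ->]; have:= aE u.
    by rewrite !ffunE Ru conjgE invgK mulgA => <-; rewrite Aut_closed.
  by have:= aE u; rewrite !ffunE Ru conjgE invgK mulgA.
case: aS => x nRx aE; apply/imsetP; exists x^-1; last first.
  apply/ffunP=> u; rewrite !ffunE.
  by case: ifP => // /aE->; rewrite conjgE invgK mulgA.
rewrite inE; apply/subsetP=> _ /imsetP[u Ru ->].
by rewrite ffunE Ru invgK -mulgA -conjgE memJ_norm.
Qed.

Lemma isoF_normJ R x : x \in 'N(R) -> isoF R R (conjg^~ x).
Proof.
move=> nRx; apply: (isoF_sub (isoF_conj R x)) => //; exact: normP nRx.
Qed.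

Lemma Aut_S_ex R x : x \in 'N(R) ->
  exists2 a, a \in Aut_S R & {in R, forall u, a u = u ^ x}.
Proof.
move=> nRx; have [a /Aut_FP[AutRa _] aE] := isoF_Aut (isoF_normJ nRx).
by exists a => //; apply/Aut_SP; split=> //; exists x.
Qed.

Lemma Aut_S_sub R : Aut_S R \subset Aut_F F R.
Proof.
apply/subsetP=> a /Aut_SP[AutRa [x nRx aE]]; apply/Aut_FP; split=> //.
by rewrite (eq_isoF _ aE) isoF_normJ.
Qed.

Lemma Aut_S_morphim R : Aut_S R = conj_aut R @* 'N(R).
Proof.
apply/setP=> a; apply/Aut_SP/morphimP=> [[AutRa [x nRx aE]] | [x nRx _ ->]].
  exists x => //; apply: eq_Aut AutRa _ _; last first.
    by move=> u Ru; rewrite aE // norm_conj_autE.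
  by rewrite (subsetP (Aut_conj_aut R 'N(R))) // mem_morphim.
split; first by rewrite (subsetP (Aut_conj_aut R 'N(R))) // mem_morphim.
by exists x => // u Ru; rewrite norm_conj_autE.
Qed.

Definition stabF R A : {group {perm S}} := (Aut_F_group F R :&: 'N(A | 'P))%G.

Lemma stabFP R A a : reflect (a \in Aut_F F R /\ a @: A = A) (a \in stabF R A).
Proof.
apply: (iffP setIP) => [] [Fa aA]; split=> //.
  apply/eqP; rewrite eqEcard card_imset ?leqnn ?andbT //; last exact: perm_inj.
  by apply/subsetP=> _ /imsetP[x Ax ->]; have /astabsP/(_ x) := aA; rewrite Ax.
apply/astabsP=> x; rewrite /= apermE -{1}aA mem_imset //; exact: perm_inj.
Qed.

End Isomorphisms.

(** * Extending morphisms up to automorphisms of their image *)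

Section Extension.

Variables (p : nat) (S : finGroupType) (F : fusion_system S).
Hypothesis pS : p.-group [set: S].
Implicit Types (A B C P Q R M T : {group S}) (f : S -> S) (x y g h : S).

(** Axiom (II) in terms of right conjugation: the condition on [M] puts it inside [Nphi], which
    always contains [Q]. Passing from left to right conjugation only replaces [g] and [h] by their
    inverses. *)
Lemma satII_extend Q R M f :
    saturation_II F Q -> isoF F Q R f -> fully_centralized F R ->
    M \subset 'N(Q) ->
    (forall g, g \in M ->
       exists2 h, h \in 'N(R) & {in Q, forall x, f (x ^ g) = f x ^ h}) ->
  exists f' T, isoF F (Q <*> M) T f' /\ {in Q, f' =1 f}.
Proof.
move=> IIQ fQR fcR nQM Mh; have fI := isoF_inj_hom fQR.
have fE x : x \in Q -> fres Q f x = f x by move=> Qx; rewrite ffunE Qx.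
have imE: img_group Q (fres Q f) = R.
  by apply: val_inj; rewrite /= fres_im (isoF_im fQR) genGid.
have [||g gF gE] := IIQ (fres Q f); [by case/andP: fQR | by rewrite imE |].
have [T0 _ gT0] := fhom_isoF gF.
have sQMN: Q <*> M \subset Nphi_group Q (fres Q f).
  rewrite join_subG; apply/andP; split; apply: sub_gen; apply/subsetP=> x Xx.
    apply/(NphiP _ fI); split; first exact: (subsetP (normG Q)).
    exists (f x) => [|y Qy].
      by rewrite fres_im (isoF_im fQR) (subsetP (normG R)) // (isoF_mem fQR).
    by rewrite !fE ?groupM ?groupV // !(isoFM fQR) ?(isoFV fQR) ?groupM ?groupV.
  apply/(NphiP _ fI); split; first exact: (subsetP nQM).
  have [h nRh hE] := Mh _ (groupVr Xx); exists h^-1 => [|y Qy].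
    by rewrite fres_im (isoF_im fQR) groupV.
  have: y ^ x^-1 \in Q by rewrite memJ_norm // groupV (subsetP nQM).
  by have:= hE y Qy; rewrite !conjgE !invgK !mulgA => E Qyx; rewrite !fE ?E.
have [T _ gT] := isoF_restr gT0 sQMN; exists g, T; split=> // x Qx.
by rewrite gE // fE.
Qed.

(* Transporting conjugation by M through f gives a p-subgroup of K, which some *)
(* element of K moves into Aut_S R; then axiom (II) applies.                   *)
Lemma extend_up_to Q R M f (K : {group {perm S}}) :
    saturation_II F Q -> isoF F Q R f -> fully_centralized F R ->
    K \subset Aut_F F R -> p.-Sylow(K) (K :&: Aut_S R) -> M \subset 'N(Q) ->
    (forall g, g \in M ->
       exists2 k, k \in K & {in Q, forall x, f (x ^ g) = k (f x)}) ->
  exists chi f' T,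
    [/\ chi \in K, isoF F (Q <*> M) T f' & {in Q, f' =1 chi \o f}].
Proof.
move=> IIQ fQR fcR sKF sylK nQM MK.
pose th g : {perm S} :=
  odflt 1 [pick k in K | [forall x in Q, f (x ^ g) == k (f x)]].
have thP g : g \in M -> th g \in K /\ {in Q, forall x, f (x ^ g) = th g (f x)}.
  move=> Mg; rewrite /th; case: pickP => [k /andP[Kk /forall_inP kE] | noK].
    by split=> // x /kE/eqP.
  have [k Kk kE] := MK g Mg; have /negP[] := noK k; rewrite Kk.
  by apply/forall_inP=> x /kE->.
have thM: {in M &, {morph th : x y / x * y}}.
  move=> g h Mg Mh; have [Kg gE] := thP g Mg; have [Kh hE] := thP h Mh.
  have [Kgh ghE] := thP _ (groupM Mg Mh).
  have AutK k : k \in K -> k \in Aut R by move/(subsetP sKF); case/Aut_FP.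
  apply: (eq_Aut (A := R)); rewrite ?AutK ?groupM // => y.
  rewrite -{1}(isoF_im fQR) => /imsetP[x Qx ->].
  rewrite -ghE // permM -gE // conjgM hE //.
  by rewrite memJ_norm // (subsetP nQM).
pose X := (Morphism thM @* M)%G.
have sXK: X \subset K.
  by apply/subsetP=> _ /morphimP[g _ Mg ->]; case: (thP g Mg).
have pX: p.-group X by rewrite morphim_pgroup ?(pgroupS _ pS) ?subsetT.
have [chi Kchi sX] := Sylow_subJ (P := (K :&: Aut_S_group R)%G) sylK sXK pX.
have chiF: chi^-1 \in Aut_F F R by rewrite groupV (subsetP sKF).
have f1QR: isoF F Q R (chi^-1 \o f) by apply: isoF_comp fQR _; case/Aut_FP: chiF.
have [|f' [T [f'T f'E]]] := satII_extend IIQ f1QR fcR nQM; last first.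
  by exists chi^-1, f', T; rewrite groupV.
move=> g Mg; have [Kg gE] := thP g Mg.
have: th g \in X by apply/morphimP; exists g.
move/(subsetP sX); rewrite mem_conjg => /setIP[_ /Aut_SP[_ [h nRh hE]]].
exists h => // x Qx; rewrite /= gE // -hE; last first.
  by rewrite (isoF_mem f1QR).
by rewrite conjgE invgK !permM permKV.
Qed.

(** This is what [extend_up_to] asks of its target when [K] is the stabilizer of [C]. *)
Definition receptive R C : Prop :=
  fully_centralized F R /\
  p.-Sylow(stabF F R C) (stabF F R C :&: Aut_S R).

Lemma Aut_S_pgroup R : p.-group (Aut_S R).
Proof. by rewrite Aut_S_morphim morphim_pgroup // (pgroupS (subsetT _)). Qed.

(** The hypothesis says that conjugation by [f] carries [X] into [Y]; it is injective because [f] is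
    injective on [Q]. *)
Lemma leq_card_transport Q R f (X Y : {set {perm S}}) :
    isoF F Q R f -> X \subset Aut Q ->
    (forall a, a \in X ->
       exists2 b, b \in Y & {in Q, forall x, b (f x) = f (a x)}) ->
  #|X| <= #|Y|.
Proof.
move=> fQR sXA XY.
pose th (a : {perm S}) : {perm S} :=
  odflt 1 [pick b in Y | [forall x in Q, b (f x) == f (a x)]].
have thP a : a \in X -> th a \in Y /\ {in Q, forall x, th a (f x) = f (a x)}.
  move=> Xa; rewrite /th; case: pickP => [b /andP[Yb /forall_inP bE] | noY].
    by split=> // x /bE/eqP.
  have [b Yb bE] := XY a Xa; have /negP[] := noY b; rewrite Yb.
  by apply/forall_inP=> x /bE->.
rewrite -(card_in_imset (f := th)) => [|a b Xa Xb thab].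
  by rewrite subset_leq_card //; apply/subsetP=> _ /imsetP[a /thP[Ya _] ->].
have AutX := subsetP sXA; apply: (eq_Aut (A := Q)); rewrite ?AutX // => x Qx.
apply: (isoF_inj fQR); rewrite ?Aut_closed ?AutX //.
by have [[_ <-] // [_ <-]] := (thP a Xa, thP b Xb); rewrite // thab.
Qed.

Lemma stabF_transport Q R A C f a : isoF F Q R f -> A \subset Q -> f @: A = C ->
  a \in stabF F Q A ->
  exists2 b, b \in stabF F R C & {in Q, forall x, b (f x) = f (a x)}.
Proof.
move=> fQR sAQ fA /stabFP[/Aut_FP[_ aQ] aA].
have [g [gRQ fg gf]] := isoF_inv fQR.
have [b Fb bE] := isoF_Aut (isoF_comp (isoF_comp gRQ aQ) fQR).
have bfE: {in Q, forall x, b (f x) = f (a x)}.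
  by move=> x Qx; rewrite bE /= ?(isoF_mem fQR) // fg.
exists b => //; apply/stabFP; split=> //; rewrite -fA -{2}aA -!imset_comp.
by apply: eq_in_imset => x Ax; apply: bfE; apply: (subsetP sAQ).
Qed.

Lemma stabF_Aut R A : stabF F R A \subset Aut R.
Proof. by apply/subsetP=> a /stabFP[/Aut_FP[]]. Qed.

Lemma card_stabF Q R A C f : isoF F Q R f -> A \subset Q -> f @: A = C ->
  #|stabF F Q A| = #|stabF F R C|.
Proof.
move=> fQR sAQ fA; have [g [gRQ fg gf]] := isoF_inv fQR.
have sCR: C \subset R by rewrite -fA -(isoF_im fQR) imsetS.
have gC: g @: C = A.
  rewrite -fA -imset_comp -[RHS]imset_id; apply: eq_in_imset => x Ax /=.
  by rewrite fg // (subsetP sAQ).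
apply/eqP; rewrite eqn_leq; apply/andP; split.
  apply: (leq_card_transport fQR); first exact: stabF_Aut.
  by move=> a; apply: stabF_transport.
apply: (leq_card_transport gRQ); first exact: stabF_Aut.
by move=> a; apply: stabF_transport.
Qed.

Lemma Sylow_of_card (gT : finGroupType) (G H X Y : {group gT}) :
  p.-Sylow(G) X -> #|G| = #|H| -> Y \subset H -> p.-group Y -> #|X| <= #|Y| ->
  p.-Sylow(H) Y.
Proof.
move=> sylX cardGH sYH pY leXY; have [Z sylZ sYZ] := Sylow_superset sYH pY.
suff ->: Y = Z by [].
apply/val_inj/eqP; rewrite eqEcard sYZ (card_Hall sylZ) -cardGH.
by rewrite -(card_Hall sylX).
Qed.

(** For a fully normalized conjugate [R] of [Q], a Sylow subgroup [T] of the stabilizer of the image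
    [C0] of [A] is conjugate in [Aut_F F R] into [Aut_S R]. Moving [C0] by the conjugating
    automorphism gives [C]. *)
Lemma exists_receptive Q A :
    (forall R, F_conj F Q R -> saturation_I p F R) -> A \subset Q ->
  exists R C f, [/\ isoF F Q R f, f @: A = C & receptive R C].
Proof.
move=> IQ sAQ; have [R QR fnR] := exists_fully_normalized F Q.
have [fcR sylR] := IQ R QR fnR; have /F_conjP[f fQR] := QR.
have [C0 _ fC0] := isoF_restr fQR sAQ.
have [T sylT] := Sylow_exists p (stabF F R C0).
have sTF: T \subset Aut_F F R.
  by rewrite (subset_trans (pHall_sub sylT)) ?subsetIl.
have [a Fa sTa] := Sylow_subJ (P := Aut_S_group R) sylR sTF (pHall_pgroup sylT).
have [_ aR] := Aut_FP _ _ _ (groupVr Fa).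
have [C _ aC] := isoF_restr (isoF_comp fQR aR) sAQ.
exists R, C, (a^-1 \o f); split; [exact: isoF_comp fQR aR | exact: isoF_im aC|].
have aC0: a^-1 @: C0 = C.
  by rewrite -(isoF_im fC0) -(isoF_im aC) -imset_comp.
split=> //; apply: (Sylow_of_card (G := stabF F R C0) (X := T)) => //.
- by apply: card_stabF aC0 => //; rewrite -(isoF_im fC0) -(isoF_im fQR) imsetS.
- exact: subsetIl.
- by rewrite (pgroupS (subsetIr _ _)) ?Aut_S_pgroup.
rewrite -(cardJg T a^-1) subset_leq_card // subsetI.
rewrite (sub_conjgV T (Aut_S R) a) sTa andbT.
apply/subsetP=> _ /imsetP[t Tt ->].
have /stabFP[Ft tC0] := subsetP (pHall_sub sylT) _ Tt.
apply/stabFP; split; first by rewrite groupJ ?groupV.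
rewrite -aC0 -{2}tC0 -!imset_comp; apply: eq_imset => x /=.
by rewrite conjgE invgK !permM permKV.
Qed.

Lemma Aut_S_stabF R A x : x \in 'N(R) -> x \in 'N(A) -> A \subset R ->
  exists2 a, a \in stabF F R A :&: Aut_S R & {in R, forall u, a u = u ^ x}.
Proof.
move=> nRx nAx sAR; have [a Sa aE] := Aut_S_ex F nRx; exists a => //.
rewrite inE Sa andbT; apply/stabFP; split; first exact: (subsetP (Aut_S_sub F R)).
rewrite -{2}(normP nAx); apply: eq_in_imset => u Au.
by rewrite aE // (subsetP sAR).
Qed.

(** The correction [chi] provided by [extend_up_to] preserves [C], so the extension still maps [A]
    to [C]. Its domain is strictly larger than [Q] as soon as [Q < 'N(A)] ([card_join_norm]). *)
Lemma receptive_extend Q R A C f :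
    isoF F Q R f -> A \subset Q -> f @: A = C -> receptive R C ->
    saturation_II F Q ->
  exists chi f' T, [/\ chi \in stabF F R C, isoF F (Q <*> 'N_('N(A))(Q)) T f',
                       {in Q, f' =1 chi \o f} & f' @: A = C].
Proof.
move=> fQR sAQ fA [fcR sylR] IIQ.
have [||g|chi [f' [T [Kchi f'T f'E]]]] :=
    extend_up_to (M := 'N_('N(A))(Q)%G) IIQ fQR fcR _ sylR.
- by apply/subsetP=> a /stabFP[].
- exact: subsetIr.
- case/setIP=> nAg nQg; have [a /setIP[Ka _] aE] := Aut_S_stabF nQg nAg sAQ.
  have [b Kb bE] := stabF_transport fQR sAQ fA Ka.
  by exists b => // x Qx; rewrite bE // aE.
exists chi, f', T; split=> //; have /stabFP[_ chiC] := Kchi.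
rewrite -chiC -fA -imset_comp; apply: eq_in_imset => x Ax.
by rewrite f'E // (subsetP sAQ).
Qed.

End Extension.

(** * A non-centric fully normalized P: mapping normalizers of conjugates into its normalizer *)

Section FullyNormalized.

Variables (p : nat) (S : finGroupType) (F : fusion_system S) (P : {group S}).
Hypothesis pS : p.-group [set: S].
Hypothesis F_gen : forall (A B : {group S}) (f : {ffun S -> S}),
  f \in F A B -> centric_generated F A B f.
Hypothesis satP : forall Q : {group S},
  #|P| < #|Q| -> saturation_I p F Q /\ saturation_II F Q.
Hypothesis ncP : ~ centric F P.
Hypothesis fnP : fully_normalized F P.
Implicit Types (A B C Q R M T : {group S}) (f : S -> S) (x y g h : S).

(** The image [T] of ['N(A)] automatically lies in ['N(P)], because [A] goes to [P]. *)
Definition embeds A : Prop :=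
  exists f T, isoF F 'N(A)%G T f /\ f @: A = P.

Lemma embeds_refl : embeds P.
Proof.
by exists id, 'N(P)%G; split; [apply: isoF_id | rewrite imset_id].
Qed.

Lemma embeds_F_conj A : embeds A -> F_conj F A P.
Proof.
by case=> f [T [fT fA]]; apply/F_conjP; exists f; apply: isoF_sub fT (normG A) fA.
Qed.

Lemma nilS A : nilpotent A.
Proof. by apply: (pgroup_nil (p := p)); apply: pgroupS pS; apply: subsetT. Qed.

Lemma card_join_norm A Q : Q \proper 'N(A) -> #|Q| < #|Q <*> 'N_('N(A))(Q)|.
Proof.
move=> pQ; apply: leq_trans (subset_leq_card (joing_subr _ _)).
by apply: proper_card; apply: (nilpotent_proper_norm (nilS _)).
Qed.

(* Downward induction on #|Q|.  One may take A = P.  If f(Q) < 'N(B), then     *)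
(* Q < 'N(P) as P is fully normalized, and P and B are linked through a        *)
(* receptive pair (R', C) by morphisms defined on groups larger than Q.        *)
Lemma embeds_step A B Q R f :
    isoF F Q R f -> A \proper Q -> Q \subset 'N(A) -> f @: A = B ->
  embeds A -> embeds B.
Proof.
have [n] := ubnP (#|[set: S]| - #|Q|); elim: n => // n IHn in A B Q R f *.
move=> leQn fQR.
move=> pAQ nAQ fA [phi [T [phiT phiA]]].
have IH A1 B1 Q1 R1 f1 : #|Q| < #|Q1| -> isoF F Q1 R1 f1 -> A1 \proper Q1 ->
    Q1 \subset 'N(A1) -> f1 @: A1 = B1 -> embeds A1 -> embeds B1.
  move=> ltQ; apply: IHn; rewrite -ltnS (leq_trans _ leQn) //.
  by rewrite ltnS ltn_sub2l // (leq_trans ltQ) // subset_leq_card ?subsetT.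
have [Q' _ phiQ'] := isoF_restr phiT nAQ.
have [phi' [phi'Q phiK phi'K]] := isoF_inv phiQ'.
have sAQ := proper_sub pAQ.
have phi'P: phi' @: P = A by apply: cancel_im phiA => x /(subsetP sAQ)/phiK.
have cardQ' := isoF_card phiQ'.
have cardA : #|A| = #|P| := isoF_card (isoF_sub phiT (normG A) phiA).
have sPQ' := isoF_im_sub phiQ' sAQ phiA.
have nPQ' := isoF_im_norm phiQ' sAQ phiA nAQ.
have {fQR} fR := isoF_comp phi'Q fQR; set f1 := f \o phi' in fR.
have f1P: f1 @: P = B by rewrite imset_comp phi'P.
have [f1' [f1'Q' f1K f1'K]] := isoF_inv fR.
have f1'B: f1' @: B = P by apply: cancel_im f1P => x /(subsetP sPQ')/f1K.
have sBR := isoF_im_sub fR sPQ' f1P.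
have nBR := isoF_im_norm fR sPQ' f1P nPQ'.
have cardR := isoF_card fR.
have ltPQ : #|P| < #|Q| by rewrite -cardA proper_card.
(* If [R] is all of ['N(B)], the inverse of [f1] is itself the required map from ['N(B)]. *)
have [eqR | pR] := eqVproper nBR.
  have eqR' : R = 'N(B)%G by apply: val_inj.
  by exists f1', Q'; rewrite -eqR'.
have PB : F_conj F P B by apply/F_conjP; exists f1; apply: isoF_sub fR sPQ' f1P.
have pQ' : Q' \proper 'N(P).
  rewrite properEcard nPQ' cardR; apply: leq_trans (fnP PB).
  exact: proper_card.
have I_Q' R1 : F_conj F Q' R1 -> saturation_I p F R1.
  case/F_conjP=> g gR1; apply: (proj1 (satP _)).
  by rewrite -(isoF_card gR1) -cardQ'.
have [IIQ' IIR] : saturation_II F Q' /\ saturation_II F R.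
  by split; apply: (proj2 (satP _)); rewrite -?cardR -cardQ'.
have [R' [C [psi [psiR' psiC recC]]]] := exists_receptive pS I_Q' sPQ'.
have [chi1 [f2 [T1 [_ f2T1 _ f2P]]]] := receptive_extend pS psiR' sPQ' psiC recC IIQ'.
have embC: embeds C.
  apply: (IH P C _ T1 f2 _ f2T1 _ _ f2P embeds_refl).
  - by rewrite cardQ' card_join_norm.
  - rewrite properEcard (subset_trans sPQ') ?joing_subl //=.
    by rewrite (leq_trans ltPQ) // cardQ' subset_leq_card ?joing_subl.
  - by rewrite join_subG nPQ' subsetIl.
have psiB : (psi \o f1') @: B = C by rewrite imset_comp f1'B.
have [chi2 [f3 [T2 [_ f3T2 _ f3B]]]] :=
    receptive_extend pS (isoF_comp f1'Q' psiR') sBR psiB recC IIR.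
have [f3' [f3'T f3K f3'K]] := isoF_inv f3T2.
have sBR2 : B \subset R <*> 'N_('N(B))(R) by rewrite (subset_trans sBR) ?joing_subl.
have nBR2 : R <*> 'N_('N(B))(R) \subset 'N(B) by rewrite join_subG nBR subsetIl.
have ltT2 : #|Q| < #|T2|.
  by rewrite -(isoF_card f3T2) cardQ' cardR card_join_norm.
apply: (IH C B T2 _ f3' ltT2 f3'T _ _ _ embC).
- rewrite properEcard (isoF_im_sub f3T2 sBR2 f3B).
  by rewrite -(isoF_card (isoF_sub f3T2 sBR2 f3B)) -(isoF_card (isoF_sub fR sPQ' f1P))
     (ltn_trans ltPQ).
- exact: isoF_im_norm f3T2 sBR2 f3B nBR2.
- by apply: cancel_im f3B => x /(subsetP sBR2)/f3K.
Qed.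

(** A conjugate of the non-centric [P] is not centric, hence differs from [Q], and normalizers grow
    in p-groups. *)
Lemma embeds_proper_norm A Q :
  embeds A -> centric F Q -> A \subset Q -> A \proper 'N_Q(A).
Proof.
move=> emA cQ sAQ; apply: (nilpotent_proper_norm (nilS _)).
rewrite properEneq sAQ andbT; apply/eqP=> /val_inj eqAQ; apply: ncP.
by apply: (centric_F_conj (embeds_F_conj emA)); rewrite eqAQ.
Qed.

(** A generating restriction comes from a morphism on a centric [Q1], hence is defined on
    ['N_Q1(A)], where [embeds_step] applies. *)
Lemma embeds_generated Q R (f : {ffun S -> S}) :
    centric_generated F Q R f ->
  forall A, A \subset Q -> embeds A ->
  exists B : {group S}, [/\ B \subset R, f @: A = B & embeds B].
Proof.
elim=> [Q1 R1 Q0 R0 {}f cQ _ fF sQ0 _ sfR | Q1 R1 T1 f1 f2 g1 IH1 g2 IH2] A sA emA.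
  have sAQ1 := subset_trans sA sQ0.
  have pAQ := embeds_proper_norm emA cQ sAQ1.
  have [T _ fT] := fhom_isoF fF.
  have [T1 _ fT1] := isoF_restr fT (subsetIl Q1 'N(A)).
  have [B _ fB] := isoF_restr fT sAQ1.
  have fA : fres Q0 f @: A = B.
    rewrite -(isoF_im fB); apply: eq_in_imset => x Ax.
    by rewrite ffunE (subsetP sA).
  exists B; split=> //; last exact: (embeds_step fT1 pAQ (subsetIr _ _) (isoF_im fB)).
  by rewrite -(isoF_im fB) (subset_trans _ sfR) ?imsetS.
have [B [sB fA emB]] := IH1 A sA emA; have [C [sC fB emC]] := IH2 B sB emB.
exists C; split=> //; rewrite -fB -fA -imset_comp.
by apply: eq_imset => x; rewrite ffunE.
Qed.

Lemma F_conj_embeds A : F_conj F P A -> embeds A.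
Proof.
move=> /F_conjP[f fPA]; have fg := F_gen (isoF_fhom fPA).
have [B [_ fB emB]] := embeds_generated fg (subxx P) embeds_refl.
suff ->: A = B by [].
by apply: val_inj; rewrite /= -fB fres_im (isoF_im fPA).
Qed.

(** * Extending automorphisms of P to P C(P) *)

Definition PC : {group S} := (P <*> 'C(P))%G.

Definition extendable f : Prop :=
  exists f', isoF F PC PC f' /\ {in P, f' =1 f}.

Lemma sub_PC : P \subset PC.
Proof. exact: joing_subl. Qed.

Lemma PCE : PC = P * 'C(P) :> {set S}.
Proof. exact: cent_joinEr. Qed.

Lemma PC_norm : PC \subset 'N(P).
Proof. by rewrite join_subG normG cent_sub. Qed.

Lemma eq_extendable f f1 : {in P, f =1 f1} -> extendable f -> extendable f1.
Proof.
by move=> ff1 [g [gPC gf]]; exists g; split=> // x Px; rewrite gf ?ff1.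
Qed.

Lemma extendable_comp f f1 :
  f @: P = P -> extendable f -> extendable f1 -> extendable (f1 \o f).
Proof.
move=> fP [g [gPC gf]] [g1 [g1PC gf1]]; exists (g1 \o g).
split=> [|x Px]; first exact: isoF_comp gPC g1PC.
by rewrite /= gf // gf1 // -fP imset_f.
Qed.

Lemma extendable_inv f (f' : S -> S) :
  f @: P = P -> {in P, cancel f f'} -> extendable f -> extendable f'.
Proof.
move=> fP fK [g [gPC gf]]; have [g' [g'PC gK _]] := isoF_inv gPC.
exists g'; split=> // y; rewrite -{1}fP => /imsetP[x Px ->].
by rewrite fK // -gf // gK // (subsetP sub_PC).
Qed.

(** A morphism preserving [P] sends ['C(P)] into ['C(P)], so it maps [PC] into itself; compare
    orders. *)
Lemma isoF_PC T f : isoF F PC T f -> f @: P = P -> T = PC.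
Proof.
move=> fT fP; apply: val_inj; apply/eqP; rewrite eqEcard /=.
rewrite -(isoF_card fT) leqnn andbT.
apply/subsetP=> y; rewrite -(isoF_im fT) => /imsetP[x + ->] /=.
rewrite !PCE => /mulsgP[u v Pu Cv ->]; have Qu := subsetP sub_PC u Pu.
have Qv : v \in PC by rewrite (subsetP (joing_subr _ _)).
rewrite (isoFM fT) // mem_mulg ?(isoF_cent fT sub_PC fP) //.
by rewrite -fP imset_f.
Qed.

Lemma extendable_full Q R f :
  isoF F Q R f -> 'C(P) \subset Q -> P \subset Q -> f @: P = P -> extendable f.
Proof.
move=> fQR sCQ sPQ fP; have sQ : PC \subset Q by rewrite join_subG sPQ.
have [T _ fT] := isoF_restr fQR sQ; exists f; split=> //.
by rewrite -{2}(isoF_PC fT fP).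
Qed.

Lemma leq_card_cent M T A B f : isoF F M T f -> A \subset M -> 'C(A) \subset M ->
  f @: A = B -> #|'C(A)| <= #|'C(B)|.
Proof.
move=> fMT sAM sCM fA; rewrite -(card_in_imset (f := f) (D := 'C(A))).
  apply/subset_leq_card/subsetP=> _ /imsetP[x Cx ->].
  exact: isoF_cent fMT sAM fA (subsetP sCM x Cx) Cx.
by move=> x y /(subsetP sCM) Mx /(subsetP sCM) My; exact: (isoF_inj fMT Mx My).
Qed.

(** A receptive pair [(R, C)] is moved to [(R', P)] by a map [phi] from ['N(C)] into ['N(P)]. This
    preserves receptivity: [phi] is defined on ['C(R)] and on the elements of ['N(R)] that normalize
    [C], so neither the centralizer nor the part of [Aut_S] in the stabilizer gets smaller. *)
Lemma exists_receptive_fixing Q : P \proper Q -> Q \subset 'N(P) ->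
  exists R f, [/\ isoF F Q R f, f @: P = P & receptive p F R P].
Proof.
move=> pPQ nPQ; have sPQ := proper_sub pPQ.
have I_Q R1 : F_conj F Q R1 -> saturation_I p F R1.
  case/F_conjP=> g gR1; apply: (proj1 (satP _)).
  by rewrite -(isoF_card gR1) proper_card.
have [R [C [f [fQR fC [fcR sylR]]]]] := exists_receptive pS I_Q sPQ.
have sCR := isoF_im_sub fQR sPQ fC.
have nCR := isoF_im_norm fQR sPQ fC nPQ.
have [|phi [T [phiT phiC]]] := @F_conj_embeds C.
  by apply/F_conjP; exists f; apply: isoF_sub fQR sPQ fC.
have [R' sR'T phiR] := isoF_restr phiT nCR.
exists R', (phi \o f); split.
- exact: isoF_comp fQR phiR.
- by rewrite imset_comp fC.
split=> [X R'X|].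
  have RX : F_conj F R X by apply: F_conj_trans R'X; apply/F_conjP; exists phi.
  apply: leq_trans (fcR X RX) _.
  apply: leq_card_cent phiT nCR _ (isoF_im phiR).
  by rewrite (subset_trans (centS sCR)) ?cent_sub.
apply: (Sylow_of_card (G := stabF F R C) (X := (stabF F R C :&: Aut_S_group R)%G)
         (Y := (stabF F R' P :&: Aut_S_group R')%G)) => //=.
- exact: card_stabF phiR sCR phiC.
- exact: subsetIl.
- by rewrite (pgroupS (subsetIr _ _)) // (Aut_S_pgroup pS).
apply: (leq_card_transport phiR) => [|a /setIP[/stabFP[_ aC] /Aut_SP[_ [x nRx aE]]]].
  by rewrite (subset_trans (subsetIl _ _)) ?stabF_Aut.
have nCx : x \in 'N(C).
  rewrite inE; apply/subsetP=> _ /imsetP[u Cu ->].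
  by rewrite -aE ?(subsetP sCR) // -aC imset_f.
have [|||b Kb bE] := Aut_S_stabF F (R := R') (A := P) (x := phi x).
- exact: isoF_norm phiT nCR (isoF_im phiR) nCx nRx.
- exact: (isoF_norm phiT (normG C) phiC nCx nCx).
- exact: isoF_im_sub phiR sCR phiC.
exists b => // u Ru; rewrite bE ?(isoF_mem phiR) // aE // (isoFJ phiT) //.
exact: (subsetP nCR).
Qed.

(** The normalizer of [R] grows inside [R <*> 'C(P)]; an element [r * c] normalizing [R] but outside
    it has its factor [c] in ['N(R)]. *)
Lemma card_join_cent R : R \subset 'N(P) -> ~~ ('C(P) \subset R) ->
  #|R| < #|R <*> 'N_('C(P))(R)|.
Proof.
move=> nPR nsCR; have nCR : R \subset 'N('C(P)).
  by rewrite (subset_trans nPR) ?cent_norm.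
apply: proper_card; apply/properP; split; first exact: joing_subl.
have pR : R \proper R <*> 'C(P).
  rewrite properE joing_subl /=; apply: contra nsCR; apply: subset_trans.
  exact: joing_subr.
have /properP[_ [x]] := nilpotent_proper_norm (nilS _) pR.
rewrite /= norm_joinEl // => /setIP[/mulsgP[r c Rr Cc ->] nRrc] nRx.
exists (r * c) => //; rewrite groupM ?(subsetP (joing_subl _ _) r) //.
apply: (subsetP (joing_subr _ _)); rewrite inE Cc.
by rewrite -(groupMl c (subsetP (normG R) r Rr)).
Qed.

(* The automorphisms of R fixing P pointwise form a normal subgroup L of the   *)
(* stabilizer of P, so kappa agrees on P with some chi * kappa, chi in L, that *)
(* extends to the elements of 'C(P) normalizing R.                             *)
Lemma stabF_extend R kappa :
    saturation_II F R -> receptive p F R P -> P \subset R -> kappa \in stabF F R P ->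
  exists f T, isoF F (R <*> 'N_('C(P))(R)) T f /\ {in P, f =1 kappa}.
Proof.
move=> IIR [fcR sylR] sPR Kk; have /stabFP[/Aut_FP[_ kR] kP] := Kk.
pose L := (stabF F R P :&: 'C(P | 'P))%G.
have nLK : L <| stabF F R P.
  by apply: normalGI (subsetIr _ _) _; apply: astab_normal.
have sylL : p.-Sylow(L) (L :&: Aut_S R).
  have:= Sylow_setI_normal (P := (stabF F R P :&: Aut_S_group R)%G) nLK sylR.
  by rewrite /= setIA (setIidPl (normal_sub nLK)).
have sLF : L \subset Aut_F F R.
  by rewrite (subset_trans (normal_sub nLK)) ?subsetIl.
have kM g : g \in 'N_('C(P))(R) ->
    exists2 k, k \in L & {in R, forall x, kappa (x ^ g) = k (kappa x)}.
  case/setIP=> Cg nRg; have nPg : g \in 'N(P) by apply: (subsetP (cent_sub P)).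
  have [a /setIP[Ka _] aE] := Aut_S_stabF F nRg nPg sPR.
  exists (a ^ kappa) => [|x Rx].
    rewrite memJ_norm ?(subsetP (normal_norm nLK)) // inE Ka; apply/astabP=> x Px.
    rewrite /= apermE aE ?(subsetP sPR) // conjgE -(centP Cg) // mulKg //.
  by rewrite conjgE !permM permK aE.
have [chi [f [T [Lchi fT fE]]]] :=
  extend_up_to pS IIR kR fcR sLF sylL (subsetIr 'C(P) 'N(R)) kM.
exists f, T; split=> // x Px; rewrite fE ?(subsetP sPR) //=.
have /setIP[_ /astabP chiC] := Lchi; apply: chiC.
by rewrite -kP imset_f.
Qed.

(** Downward induction on [#|Q|], ending when ['C(P)] lies in [Q]. Otherwise [f] factors on [P] into
    three maps, each of which agrees on [P] with a morphism defined on a larger group or on a group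
    containing ['C(P)]. *)
Lemma normal_extendable Q R f : isoF F Q R f -> P \proper Q -> Q \subset 'N(P) ->
  f @: P = P -> extendable f.
Proof.
have [n] := ubnP (#|[set: S]| - #|Q|); elim: n => // n IHn in Q R f *.
move=> leQn fQR pPQ nPQ fP; have sPQ := proper_sub pPQ.
have IH M T f1 : #|Q| < #|M| -> isoF F M T f1 -> P \subset M ->
    M \subset 'N(P) -> f1 @: P = P -> extendable f1.
  move=> ltQ f1T sPM; apply: IHn f1T _; last first.
    by rewrite properEcard sPM (ltn_trans _ ltQ) ?proper_card.
  rewrite -ltnS (leq_trans _ leQn) //.
  by rewrite ltnS ltn_sub2l // (leq_trans ltQ) // subset_leq_card ?subsetT.
have [sCQ | nsCQ] := boolP ('C(P) \subset Q).
  exact: extendable_full fQR sCQ sPQ fP.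
have pQ : Q \proper 'N(P).
  by rewrite properE nPQ; apply: contra nsCQ; apply: subset_trans (cent_sub P).
have [R0 [psi [psiR0 psiP recR0]]] := exists_receptive_fixing pPQ nPQ.
have ltPQ := proper_card pPQ; have cardR := isoF_card fQR.
have cardR0 := isoF_card psiR0.
have sPR := isoF_im_sub fQR sPQ fP; have nPR := isoF_im_norm fQR sPQ fP nPQ.
have sPR0 := isoF_im_sub psiR0 sPQ psiP.
have nPR0 := isoF_im_norm psiR0 sPQ psiP nPQ.
have [IIQ IIR IIR0] : [/\ saturation_II F Q, saturation_II F R & saturation_II F R0].
  by split; apply: (proj2 (satP _)); rewrite -?cardR -?cardR0.
have [chi1 [f1 [T1 [K1 f1T1 f1E f1P]]]] := receptive_extend pS psiR0 sPQ psiP recR0 IIQ.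
have [f' [f'Q fK f'K]] := isoF_inv fQR.
have f'P : f' @: P = P by apply: cancel_im fP => x /(subsetP sPQ)/fK.
have psi'P : (psi \o f') @: P = P by rewrite imset_comp f'P.
have [chi2 [f2 [T2 [K2 f2T2 f2E f2P]]]] :=
  receptive_extend pS (isoF_comp f'Q psiR0) sPR psi'P recR0 IIR.
have sPj M : P \subset M -> P \subset M <*> 'N_('N(P))(M).
  by move/subset_trans; apply; apply: joing_subl.
have nPj M : M \subset 'N(P) -> M <*> 'N_('N(P))(M) \subset 'N(P).
  by move=> nPM; rewrite join_subG nPM subsetIl.
have ext1 : extendable f1.
  by apply: IH f1T1 (sPj _ sPQ) (nPj _ nPQ) f1P; apply: card_join_norm.
have pR : R \proper 'N(P) by rewrite properEcard nPR -cardR proper_card.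
have ext2 : extendable f2.
  by apply: IH f2T2 (sPj _ sPR) (nPj _ nPR) f2P; rewrite cardR card_join_norm.
have [f2' [f2'T f2K f2'K]] := isoF_inv f2T2.
have {}f2K : {in P, cancel f2 f2'} by move=> x /(subsetP (sPj _ sPR))/f2K.
(* Permutations compose from left to right, so [kappa] takes [chi1 \o psi] to [chi2 \o psi]; hence
   [f] agrees on [P] with [f2' \o (kappa \o f1)]. *)
pose kappa := chi1^-1 * chi2.
have Kk : kappa \in stabF F R0 P by rewrite groupM ?groupV.
have /stabFP[/Aut_FP[_ kR0] kP] := Kk.
have extk : extendable kappa.
  have [sCR0 | nsCR0] := boolP ('C(P) \subset R0).
    exact: extendable_full kR0 sCR0 sPR0 kP.
  have [f3 [T3 [f3T3 f3E]]] := stabF_extend IIR0 recR0 sPR0 Kk.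
  apply: (eq_extendable f3E); apply: IH f3T3 _ _ _.
  - by rewrite cardR0 card_join_cent.
  - by rewrite (subset_trans sPR0) ?joing_subl.
  - by rewrite join_subG nPR0 subIset ?cent_sub.
  - by rewrite (eq_in_imset f3E).
have ext2' := extendable_inv f2P f2K ext2.
apply: (@eq_extendable (f2' \o (kappa \o f1))) => [x Px /=|].
  have Qx := subsetP sPQ x Px; have Pfx : f x \in P by rewrite -fP imset_f.
  rewrite -[RHS]f2K // f1E // f2E ?(subsetP sPR) //= fK // permM.
  by rewrite permK.
apply: extendable_comp ext2'; first by rewrite imset_comp f1P.
exact: extendable_comp.
Qed.

(** Intermediate groups of a composite need not be [P], so each link is brought back to [P] by
    embeddings [sg] and [tu] of normalizers. For a restriction, the resulting map is defined on the
    image under [sg] of ['N_Q1(A)], and [normal_extendable] applies; at a composition the two links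
    share one embedding of the middle group. *)
Lemma generated_extendable Q R (f : {ffun S -> S}) :
    centric_generated F Q R f ->
  forall A B T U (sg tu : S -> S), A \subset Q -> f @: A = B ->
    isoF F 'N(A)%G T sg -> sg @: A = P -> isoF F 'N(B)%G U tu -> tu @: B = P ->
  exists al, isoF F PC PC al /\ {in A, forall x, al (sg x) = tu (f x)}.
Proof.
elim=> [Q1 R1 Q0 R0 {}f cQ _ fF sQ0 _ _ | Q1 R1 T1 f1 f2 g1 IH1 g2 IH2] A B T U sg tu.
  move=> sA fA sgT sgA tuU tuB; have sAQ1 := subset_trans sA sQ0.
  have emA : embeds A by exists sg, T.
  have pAQ := embeds_proper_norm emA cQ sAQ1.
  have fE x : x \in A -> fres Q0 f x = f x.
    by move=> Ax; rewrite ffunE (subsetP sA).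
  have {}fA : f @: A = B by rewrite -fA; apply: eq_in_imset => x /fE.
  have sAN := proper_sub pAQ; have nAN : 'N_Q1(A) \subset 'N(A) := subsetIr _ _.
  have [V _ fV] := fhom_isoF fF.
  have [V1 _ fV1] := isoF_restr fV (subsetIl Q1 'N(A)).
  have [N' _ sgN'] := isoF_restr sgT nAN.
  have [sg' [sg'N sgK _]] := isoF_inv sgN'.
  have [W _ tuW] := isoF_restr tuU (isoF_im_norm fV1 sAN fA nAN).
  have sg'P : sg' @: P = A by apply: cancel_im sgA => x /(subsetP sAN)/sgK.
  have sPN' := isoF_im_sub sgN' sAN sgA.
  have [||al [alPC alE]] :=
      normal_extendable (isoF_comp (isoF_comp sg'N fV1) tuW) _
        (isoF_im_norm sgN' sAN sgA nAN).
  - rewrite properEcard sPN' -(isoF_card sgN').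
    by rewrite -(isoF_card (isoF_sub sgT (normG A) sgA)) proper_card.
  - by rewrite imset_comp (imset_comp f) sg'P fA.
  exists al; split=> // x Ax; rewrite alE /= ?sgK ?fE //; first exact: (subsetP sAN).
  by rewrite -sgA imset_f.
move=> sA fA sgT sgA tuU tuB; have emA : embeds A by exists sg, T.
have [B1 [sB1 f1A [tu1 [U1 [tuU1 tuB1]]]]] := embeds_generated g1 sA emA.
have f2B1 : f2 @: B1 = B.
  by rewrite -f1A -fA -imset_comp; apply: eq_imset => x; rewrite ffunE.
have [al1 [al1PC al1E]] := IH1 _ _ _ _ _ _ sA f1A sgT sgA tuU1 tuB1.
have [al2 [al2PC al2E]] := IH2 _ _ _ _ _ _ sB1 f2B1 tuU1 tuB1 tuU tuB.
exists (al2 \o al1); split=> [|x Ax]; first exact: isoF_comp al1PC al2PC.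
by rewrite /= al1E // al2E ?ffunE // -f1A imset_f.
Qed.

Lemma aut_extendable f : isoF F P P f -> extendable f.
Proof.
move=> fP; have fE : {in P, fres P f =1 f} by move=> x Px; rewrite ffunE Px.
have fresP : fres P f @: P = P by rewrite fres_im (isoF_im fP).
have [al [alPC alE]] :=
  generated_extendable (F_gen (isoF_fhom fP)) (subxx P) fresP
    (isoF_id F 'N(P)%G) (imset_id _) (isoF_id F 'N(P)%G) (imset_id _).
by exists al; split=> // x Px; rewrite alE ?fE.
Qed.

(** * The saturation axioms on the conjugacy class of P *)

Lemma fully_centralized_P : fully_centralized F P.
Proof.
move=> A /F_conj_embeds[f [T [fT fA]]].
exact: leq_card_cent fT (normG A) (cent_sub A) fA.
Qed.

(** If ['C(P)] lay in [P], an isomorphism onto a conjugate [A] would map it into ['Z(A)]; since [P]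
    is fully centralized this forces ['C(A) = 'Z(A)], making [P] centric. *)
Lemma proper_PC : P \proper PC.
Proof.
rewrite properE sub_PC join_subG subxx /=; apply/negP=> sCP; apply: ncP => A PA.
apply/eqP; rewrite eq_sym eqEcard subsetIr (leq_trans (fully_centralized_P PA)) //.
have /F_conjP[f fPA] := PA; have fI := isoF_inj fPA.
rewrite -(card_in_imset (f := f)); last first.
  by move=> x y /(subsetP sCP) Px /(subsetP sCP) Py; apply: fI.
apply/subset_leq_card/subsetP=> _ /imsetP[x Cx ->]; have Px := subsetP sCP x Cx.
by rewrite inE (isoF_mem fPA) // (isoF_cent fPA (subxx P) (isoF_im fPA)).
Qed.

Lemma receptive_PC : receptive p F PC P.
Proof.
have [R [f [fR fP]]] := exists_receptive_fixing proper_PC PC_norm.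
by rewrite (isoF_PC fR fP).
Qed.

Lemma norm_PC : 'N(P) \subset 'N(PC).
Proof. by rewrite normsY ?cent_norm. Qed.

Lemma restr_perm_Aut_S R A a : A \subset R -> a \in stabF F R A -> a \in Aut_S R ->
  restr_perm A a \in Aut_S A.
Proof.
move=> sAR /setIP[_ nAa] /Aut_SP[AutRa [x nRx aE]].
have aA : {in A, forall u, restr_perm A a u = u ^ x}.
  by move=> u Au; rewrite restr_permE ?aE ?(subsetP sAR).
apply/Aut_SP; split; first exact: Aut_restr_perm AutRa.
exists x => //; rewrite inE; apply/subsetP=> _ /imsetP[u Au ->].
by rewrite -aA // -{2}(im_restr_perm A a) imset_f.
Qed.

Lemma restr_perm_stabF R A : A \subset R ->
  restr_perm A @* stabF F R A \subset Aut_F F A.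
Proof.
move=> sAR; apply/subsetP=> _ /morphimP[a nAa Ka ->].
have /stabFP[/Aut_FP[AutRa aR] aA] := Ka.
apply/Aut_FP; split; first exact: Aut_restr_perm AutRa.
by rewrite (eq_isoF _ _ (g := a)) ?(isoF_sub aR) // => x Ax; rewrite restr_permE.
Qed.

(** Restriction to [P] is onto [Aut_F F P] by [aut_extendable], and onto [Aut_S P] because ['N(P)]
    normalizes [PC]. Surjections preserve Sylow subgroups. *)
Lemma Sylow_Aut_S_P : p.-Sylow(Aut_F F P) (Aut_S P).
Proof.
have [_ sylPC] := receptive_PC; have sPPC := sub_PC.
have sKN : stabF F PC P \subset 'N(P | 'P) := subsetIr _ _.
have := morphim_pHall (G := stabF F PC P) (H := (stabF F PC P :&: Aut_S_group PC)%G)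
          (restr_perm P) (subset_trans (subsetIl _ _) sKN) sylPC.
suff [-> ->] : restr_perm P @* stabF F PC P = Aut_F F P /\
   restr_perm P @* (stabF F PC P :&: Aut_S_group PC)%G = Aut_S P by [].
have restrE a b : a \in Aut P -> b \in stabF F PC P -> {in P, b =1 a} ->
    a = restr_perm P b.
  move=> AutPa Kb bE; have [/setIP[Fb nPb]] := (Kb, Kb); case/Aut_FP: Fb => AutPCb _ _.
  apply: (eq_Aut (A := P)) => // [|x Px]; first exact: Aut_restr_perm AutPCb.
  by rewrite restr_permE // bE.
split; apply/eqP; rewrite eqEsubset.
  rewrite restr_perm_stabF //=; apply/subsetP=> a /Aut_FP[AutPa aP].
  have [al [alPC alE]] := aut_extendable aP; have [b Fb bE] := isoF_Aut alPC.
  have bP : {in P, b =1 a} by move=> x Px; rewrite bE ?alE // (subsetP sPPC).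
  have Kb : b \in stabF F PC P.
    by apply/stabFP; split=> //; rewrite (eq_in_imset bP) (isoF_im aP).
  by apply/morphimP; exists b; rewrite ?(subsetP sKN) //; apply: restrE.
apply/andP; split; apply/subsetP=> a.
  by case/morphimP=> b nPb /setIP[Kb Sb] ->; apply: restr_perm_Aut_S Kb Sb.
case/Aut_SP=> AutPa [x nPx aE].
have [b KSb bE] := Aut_S_stabF F (subsetP norm_PC x nPx) nPx sPPC.
have [Kb _] := setIP KSb; apply/morphimP; exists b; rewrite ?(subsetP sKN) //.
by apply: restrE => // u Pu; rewrite bE ?aE // (subsetP sPPC).
Qed.

(** Axiom (II) is applied to an extension of [f] to [PC], with corrections restricted to the group
    [K] of those acting on [P] as elements of ['N(P)]. *)
Lemma aut_extend_norm M f : isoF F P P f -> M \subset 'N(P) ->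
    (forall g, g \in M ->
       exists2 h, h \in 'N(P) & {in P, forall x, f (x ^ g) = f x ^ h}) ->
  exists f' T, isoF F (PC <*> M) T f' /\ {in P, f' =1 f}.
Proof.
move=> fP nPM Mh; have [al [alPC alE]] := aut_extendable fP.
have [fcPC sylPC] := receptive_PC; have sPPC := sub_PC.
pose K := (stabF F PC P :&: restr_perm P @*^-1 Aut_S_group P)%G.
have sKst : K \subset stabF F PC P := subsetIl _ _.
have sKF : K \subset Aut_F F PC by rewrite (subset_trans sKst) ?subsetIl.
have sTK : stabF F PC P :&: Aut_S PC \subset K.
  apply/subsetP=> a /setIP[Ka Sa]; rewrite inE Ka; have [_ nPa] := setIP Ka.
  by rewrite mem_morphpre // (restr_perm_Aut_S sPPC Ka Sa).
have sylK : p.-Sylow(K) (K :&: Aut_S PC).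
  have -> : K :&: Aut_S PC = stabF F PC P :&: Aut_S PC.
    by apply/eqP; rewrite eqEsubset setSI // subsetI sTK subsetIr.
  exact: (pHall_subl (H := (stabF F PC P :&: Aut_S_group PC)%G) sTK sKst sylPC).
have IIPC : saturation_II F PC by apply: (proj2 (satP _)); apply: proper_card proper_PC.
have alP : al @: P = P by rewrite (eq_in_imset alE) (isoF_im fP).
have kM g : g \in M -> exists2 k, k \in K & {in PC, forall x, al (x ^ g) = k (al x)}.
  move=> Mg; have nPg := subsetP nPM g Mg.
  have [a /setIP[Ka _] aE] := Aut_S_stabF F (subsetP norm_PC g nPg) nPg sPPC.
  have [b Kb bE] := stabF_transport alPC sPPC alP Ka.
  exists b => [|x PCx]; last by rewrite bE // aE.
  have [Fb nPb] := setIP Kb; have [AutPCb _] := Aut_FP _ _ _ Fb.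
  rewrite inE Kb mem_morphpre //; apply/Aut_SP.
  split; first exact: Aut_restr_perm AutPCb.
  have [h nPh hE] := Mh g Mg; exists h => // y Py; rewrite restr_permE //.
  move: Py; rewrite -{1}alP => /imsetP[x Px ->].
  by rewrite bE ?aE ?(subsetP sPPC) // !alE ?hE // memJ_norm.
have [chi [f' [T [Kchi f'T f'E]]]] :=
  extend_up_to pS IIPC alPC fcPC sKF sylK (subset_trans nPM norm_PC) kM.
have /setIP[_ /morphpreP[nPchi /Aut_SP[_ [h nPh chiE]]]] := Kchi.
(* The correction [chi] acts on [P] as conjugation by [h], which conjugation by [h^-1] undoes. *)
exists (conjg^~ h^-1 \o f'), (T :^ h^-1)%G; split=> [|x Px].
  exact: isoF_comp f'T (isoF_conj _ _ _).
have Pfx : f x \in P by apply: isoF_mem fP Px.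
rewrite /= f'E ?(subsetP sPPC) //= alE // -(restr_permE nPchi) //.
by rewrite chiE // conjgK.
Qed.

(** With [sg] and [rho] embedding ['N(A)] and ['N(B)] into ['N(P)], the morphism [f] becomes an
    automorphism [al] of [P]. Its extension, pulled back along [sg] to [f2], must land in the image
    of [rho] so that [rho] can be inverted. *)
Lemma satII_conj A : F_conj F P A -> saturation_II F A.
Proof.
move=> PA f fF fcB; have [B _ fAB] := fhom_isoF fF.
have imE : img_group A f = B by apply: val_inj; rewrite /= (isoF_im fAB) genGid.
rewrite {}imE in fcB; set M := Nphi_group A f.
have fI := subsetP (fhom_inj F _ _) f fF.
have ME : M = Nphi A f :> {set S} by apply: gen_set_id; apply: Nphi_group_set fI.
have nAM : M \subset 'N(A).
  by rewrite ME; apply/subsetP=> g /(NphiP _ fI)[].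
have Mh g : g \in M ->
    exists2 h, h \in 'N(B) & {in A, forall x, f (x ^ g) = f x ^ h}.
  rewrite -groupV ME => /(NphiP _ fI)[_ [h nBh hE]].
  exists h^-1 => [|x Ax]; first by rewrite groupV -(isoF_im fAB).
  by have:= hE x Ax; rewrite !conjgE !invgK mulgA => ->; rewrite mulgA.
have sAM : A \subset M.
  rewrite ME; apply/subsetP=> x Ax; apply/(NphiP _ fI).
  split; first exact: (subsetP (normG A)).
  exists (f x) => [|y Ay].
    by rewrite (isoF_im fAB) (subsetP (normG B)) // (isoF_mem fAB).
  by rewrite !(isoFM fAB) ?(isoFV fAB) ?groupM ?groupV.
have AB : F_conj F A B by apply/F_conjP; exists f.
have [sg [T1 [sgT1 sgA]]] := F_conj_embeds PA.
have [rho [T2 [rhoT2 rhoB]]] := F_conj_embeds (F_conj_trans PA AB).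
have sgAP := isoF_sub sgT1 (normG A) sgA.
have rhoBP := isoF_sub rhoT2 (normG B) rhoB.
have [sg' [sg'P sgK _]] := isoF_inv sgAP.
have alP := isoF_comp (isoF_comp sg'P fAB) rhoBP.
set al := rho \o (f \o sg') in alP.
have alE x : x \in A -> al (sg x) = rho (f x) by move=> Ax; rewrite /al /= sgK.
have [M' _ sgM'] := isoF_restr sgT1 nAM.
have nPM' := isoF_im_norm sgM' sAM sgA nAM.
have [g|f1 [T [f1T f1E]]] := aut_extend_norm alP nPM'.
  rewrite -(isoF_im sgM') => /imsetP[g0 Mg0 ->]; have [h nBh hE] := Mh g0 Mg0.
  exists (rho h); first exact: (isoF_norm rhoT2 (normG B) rhoB nBh nBh).
  move=> y; rewrite -{1}sgA => /imsetP[x Ax ->].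
  have Axg : x ^ g0 \in A by rewrite memJ_norm // (subsetP nAM).
  rewrite -(isoFJ sgM' (subsetP sAM x Ax) Mg0) !alE // hE // (isoFJ rhoT2) //.
  by rewrite (subsetP (normG B)) // (isoF_mem fAB).
have [T' _ f1T'] := isoF_restr f1T (joing_subr PC M').
have f2T' := isoF_comp sgM' f1T'; set f2 := f1 \o sg in f2T'.
have f2E x : x \in A -> f2 x = rho (f x).
  by move=> Ax; rewrite /f2 /= f1E ?alE // -sgA imset_f.
(* The inclusion into ['C(P)] is an equality by orders, [B] being fully centralized. *)
have rhoC : rho @: 'C(B) = 'C(P).
  apply/eqP; rewrite eqEcard; apply/andP; split.
    apply/subsetP=> _ /imsetP[c Cc ->].
    exact: isoF_cent rhoT2 (normG B) rhoB (subsetP (cent_sub B) c Cc) Cc.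
  rewrite card_in_imset; first by apply: fcB; apply/F_conjP; exists rho.
  move=> x y /(subsetP (cent_sub B)) nBx /(subsetP (cent_sub B)) nBy.
  exact: (isoF_inj rhoT2 nBx nBy).
have sT'T2 : T' \subset T2.
  apply/subsetP=> y; rewrite -(isoF_im f2T') => /imsetP[g Mg ->].
  have [h nBh hE] := Mh g Mg.
  (* Both [f2 g] and [rho h] induce the same conjugation on [P], so they differ by an element of
     ['C(P)], which is in the image of [rho]. *)
  rewrite -(mulgKV (rho h) (f2 g)) groupM //; last exact: isoF_mem rhoT2 nBh.
  have : f2 g * (rho h)^-1 \in 'C(P).
    apply/centP=> y'; rewrite -{1}rhoB => /imsetP[y1].
    rewrite -{1}(isoF_im fAB) => /imsetP[x Ax ->] ->.
    have Axg : x ^ g \in A by rewrite memJ_norm // (subsetP nAM).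
    apply/commute_sym/commgP/conjg_fixP; rewrite conjgM -f2E //.
    rewrite -(isoFJ f2T' (subsetP sAM x Ax) Mg) !f2E // hE // (isoFJ rhoT2) ?conjgK //.
    by rewrite (subsetP (normG B)) // (isoF_mem fAB).
  rewrite -rhoC => /imsetP[c Cc ->].
  exact: isoF_mem rhoT2 (subsetP (cent_sub B) c Cc).
have [rho' [rho'B rhoK _]] := isoF_inv rhoT2.
have [T'' _ rho'T''] := isoF_restr rho'B sT'T2.
have gM := isoF_comp f2T' rho'T''; exists (fres M (rho' \o f2)).
  by case/andP: gM.
move=> x Ax; rewrite ffunE (subsetP sAM) //= f2E // rhoK //.
by rewrite (subsetP (normG B)) // (isoF_mem fAB).
Qed.

End FullyNormalized.

Theorem theorem1 (p : nat) (S : finGroupType) (F : fusion_system S)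
    (p_prime : prime p) (pS : p.-group [set: S])
    (F_gen : forall (P Q : {group S}) (f : {ffun S -> S}),
       f \in F P Q -> centric_generated F P Q f)
    (F_sat : forall P : {group S},
       centric F P -> saturation_I p F P /\ saturation_II F P) :
  saturated p F.
Proof.
move=> P; have [n] := ubnP (#|[set: S]| - #|P|); elim: n => // n IHn in P *.
move=> lePn.
have satP (Q : {group S}) :
    #|P| < #|Q| -> saturation_I p F Q /\ saturation_II F Q.
  move=> ltPQ; apply: IHn; rewrite -ltnS (leq_trans _ lePn) // ltnS.
  by rewrite ltn_sub2l // (leq_trans ltPQ) // subset_leq_card ?subsetT.
have [cP | ncP] := centric_reflect F P; first exact: F_sat.
split=> [fnP|].
  by split; [apply: (fully_centralized_P pS) | apply: (Sylow_Aut_S_P pS)].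
(* Axiom (II) concerns an arbitrary [P], so the section is applied to a fully normalized conjugate
   [R], of the same order. *)
have [R PR fnR] := exists_fully_normalized F P.
have /F_conjP[f /isoF_card cardR] := PR; have RP := F_conj_sym PR.
rewrite cardR in satP; apply: (satII_conj pS F_gen satP _ fnR RP) => cR.
by apply: ncP; apply: centric_F_conj RP cR.
Qed.
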